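(* There is an absolute constant $c>0$ such that for every integer $m\ge 2$ the following holds. There exist a set $\mathcal{X}\subseteq\mathbb{R}$ of $n=4m-3$ points, the number of clusters $k=2m-1$, and an initial clustering of $\mathcal{X}$ into $k$ clusters, such that some execution of the Hartigan--Wong method on $\mathcal{X}$ starting from this clustering performs at least $2^{cn}$ iterations before reaching a local optimum. In other words, the Hartigan--Wong method can take $2^{\Omega(n)}$ iterations to converge, even on instances of $k$-means clustering on the line.
   Context: For a finite nonempty set $S\subseteq\mathbb{R}^d$ let $\operatorname{cm}(S)=\frac{1}{|S|}\sum_{x\in S}x$. Given a finite set $\mathcal{X}\subseteq\mathbb{R}^d$ and an integer $k$, a clustering is a partition $C=(C_1,\dots,C_k)$ of $\mathcal{X}$ into $k$ labeled nonempty clusters, and its cost ($k$-means objective) is $\Phi(C)=\sum_{i=1}^k\sum_{x\in C_i}\|x-\operatorname{cm}(C_i)\|^2$ (with the convention that an empty cluster contributes $0$). The Hartigan--Wong method starts from an arbitrary clustering and repeatedly performs an iteration: choose a point $x\in C_i$ and an index $j\ne i$ such that moving $x$ from $C_i$ to $C_j$ strictly decreases $\Phi$, and perform this move. Any such choice may be made (the choice of point and target cluster is arbitrary among improving moves). The method terminates when no improving move exists; the clustering is then a local optimum. The running time is the number of iterations. *)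

(* Defs.v *)
From mathcomp Require Import all_boot all_order all_algebra finmap.
From mathcomp Require Import reals exp.

Set Implicit Arguments.
Unset Strict Implicit.
Unset Printing Implicit Defensive.

Import Order.TTheory GRing.Theory Num.Theory.
Local Open Scope ring_scope.

Section KMeans.
Variables (R : realType) (d : nat).

(* The library's norm on row vectors is the sup norm, hence this definition. *)
Definition sqnorm (v : 'rV[R]_d) : R := \sum_(i < d) v ord0 i ^+ 2.

Variables (X : {fset 'rV[R]_d}) (k : nat).

Definition cm (S : {set X}) : 'rV[R]_d :=
  (#|S|%:R)^-1 *: \sum_(x in S) fsval x.

(* A partition of X into k labeled clusters, given by the label of each point;
   some clusters may be empty. *)
Definition labeling := {ffun X -> 'I_k}.

Implicit Types C D : labeling.

Definition cluster C (i : 'I_k) : {set X} := [set x | C x == i].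

Definition is_clustering C : bool := [forall i, cluster C i != set0].

Definition Phi C : R :=
  \sum_(i < k) \sum_(x in cluster C i) sqnorm (fsval x - cm (cluster C i)).

Definition move C (x : X) (j : 'I_k) : labeling :=
  [ffun y => if y == x then j else C y].

Definition improving C (x : X) (j : 'I_k) : bool :=
  (j != C x) && (Phi (move C x j) < Phi C).

(* The result of an improving move on a clustering is again a clustering:
   removing the only point of a cluster never decreases Phi. *)
Definition hw_step : rel labeling :=
  fun C D => [exists x, exists j, improving C x j && (D == move C x j)].

Definition local_optimum C : bool :=
  [forall x, forall j, ~~ improving C x j].

(* The complete execution C0 :: s performs size s iterations. *)
Definition hw_execution C0 (s : seq labeling) : bool :=
  path hw_step C0 s && local_optimum (last C0 s).

End KMeans.

(* Main.v *)
Require Import Defs.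
From mathcomp Require Import all_boot all_order all_algebra finmap.
From mathcomp Require Import reals exp.
From mathcomp Require Import ring lra zify.

Set Implicit Arguments.
Unset Strict Implicit.
Unset Printing Implicit Defensive.

Import Order.TTheory GRing.Theory Num.Theory.
Local Open Scope ring_scope.

(* Gadget i (0 <= i < m-1) consists of the points 10^i a, 10^i b, 10^i p, 10^i q
   with a = -5, b = 5, p = 3, q = 4, and has two clusters A and B, with a in A
   and b in B throughout. In phase 0 both p and q are in A; in phase s it is s
   of them (p first) that have reached B; in phase 2 the gadget is asleep. The
   remaining point 0 forms the remaining cluster and is idle.
   Instead of moving p (and later q) directly from A to B, gadget i can route it
   through the cluster B of gadget i-1. Seen from there the visitor is far away,
   so it pulls the centre of B away from p_(i-1) and q_(i-1), which flee to A;
   the visitor then leaves for its own cluster B, and gadget i-1 is back in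
   phase 0. Hence each gadget wakes up its predecessor twice before it falls
   asleep, and the number of iterations doubles with each gadget; afterwards the
   method is continued arbitrarily until it stops. Only two
   neighbouring gadgets interact, always at the same relative scale, so
   finitely many numerical inequalities suffice: since
   Phi = sum_x x^2 - sum_C (sum_(x in C) x)^2 / |C|,
   an improving move is one that increases the second sum. *)

(** An improving move strictly lowers [Phi], so the finite number of labelings cheaper than the
    current one drops. Any sequence of improving moves can thus be continued to a local optimum. *)
Lemma ex_hw_execution (R : realType) (d : nat) (X : {fset 'rV[R]_d}) (k : nat)
    (C : labeling X k) : exists s, hw_execution C s.
Proof.
have [n] := ubnP #|[set D : labeling X k | Phi D < Phi C]|.
elim: n C => // n IH C ltn.
have [opt|] := boolP (local_optimum C); first by exists [::].
rewrite negb_forall => /existsP[x]; rewrite negb_forall => /existsP[j].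
rewrite negbK => imp; have /andP[_ ltC] := imp.
have [|s /andP[ps os]] := IH (move C x j).
  rewrite -ltnS; apply: leq_trans ltn; rewrite ltnS; apply: proper_card.
  apply/properP; split; last by exists (move C x j); rewrite !inE ?ltxx.
  by apply/subsetP => D; rewrite !inE => /lt_trans; apply.
exists (move C x j :: s); rewrite /hw_execution /= ps os !andbT.
by apply/existsP; exists x; apply/existsP; exists j; rewrite imp eqxx.
Qed.

(** * Moves and energy over abstract finite types of points and labels *)

Definition upd {I : finType} {L : Type} (c : {ffun I -> L}) (x : I) (l : L) :
    {ffun I -> L} :=
  [ffun y => if y == x then l else c y].

Lemma updE (I : finType) (L : Type) (c : {ffun I -> L}) x l y :
  upd c x l y = if y == x then l else c y.
Proof. by rewrite ffunE. Qed.

Section Energy.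
Variables (R : realType) (I L : finType).
Implicit Types (f pos : I -> R) (c : {ffun I -> L}) (x : I) (l : L).

(** With [f = pos] this is the sum of a cluster, with [f = fun=> 1] its size; one update rule serves
    both. *)
Definition mass f c l : R := \sum_(x | c x == l) f x.

(* An empty cluster contributes 0 / 0 = 0. *)
Definition energy pos c : R :=
  \sum_l mass pos c l ^+ 2 / mass (fun=> 1) c l.

Lemma mass_upd f c x l l' :
  mass f (upd c x l') l =
  mass f c l - (if l == c x then f x else 0) + (if l == l' then f x else 0).
Proof.
rewrite /mass big_mkcond [in RHS]big_mkcond /= (bigD1 x) //= [in RHS](bigD1 x) //=.
rewrite ffunE eqxx [l == _]eq_sym [l == l']eq_sym.
have -> : \sum_(i | i != x) (if upd c x l' i == l then f i else 0) =
          \sum_(i | i != x) (if c i == l then f i else 0).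
  by apply: eq_bigr => i /negPf nix; rewrite ffunE nix.
by ring.
Qed.

Definition gains pos c x l : bool :=
  (l != c x) && (energy pos c < energy pos (upd c x l)).

Definition gain_step pos : rel {ffun I -> L} :=
  fun c c' => [exists x, exists l, gains pos c x l && (c' == upd c x l)].

(** Only the energy terms of the source and target clusters change, so comparing these two
    suffices. *)
Lemma gain_step_upd pos c x l :
  let n := mass (fun=> 1) c in let m := mass pos c in
  l != c x ->
  m (c x) ^+ 2 / n (c x) + m l ^+ 2 / n l <
    (m (c x) - pos x) ^+ 2 / (n (c x) - 1) + (m l + pos x) ^+ 2 / (n l + 1) ->
  gain_step pos c (upd c x l).
Proof.
move=> n m nl lt; apply/existsP; exists x; apply/existsP; exists l.
rewrite eqxx andbT /gains nl /= /energy -/m -/n.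
rewrite (bigD1 (c x)) // (bigD1 l) //= [ltRHS](bigD1 (c x)) // [X in _ < _ + X](bigD1 l) //=.
rewrite !mass_upd !eqxx [c x == l]eq_sym (negPf nl) -/m -/n !addrA !addr0 !subr0.
set P := (X in _ + X < _); set Q := (X in _ < _ + X).
suff -> : P = Q by rewrite ltrD2r.
apply: eq_bigr => l' /andP[n1 n2]; rewrite !mass_upd.
by rewrite (negPf n1) (negPf n2) !subr0 !addr0.
Qed.

End Energy.

(** * Transfer from abstract points to point sets on the line *)

Section Transfer.
Variables (R : realType) (I L : finType) (pos : I -> R).
Hypothesis pos_inj : injective pos.
Variables (k : nat) (h : L -> 'I_k).
Hypothesis h_bij : bijective h.
Implicit Types (c : {ffun I -> L}) (x : I) (l : L).

Definition point (x : I) : 'rV[R]_1 := const_mx (pos x).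

Definition points : {fset 'rV[R]_1} := [fset y in [seq point x | x : I]]%fset.

Lemma point_in x : point x \in points.
Proof. by rewrite !inE map_f ?mem_enum. Qed.

Definition emb (x : I) : points := [` point_in x]%fset.

Lemma point_inj : injective point.
Proof. by move=> x y /matrixP/(_ ord0 ord0); rewrite !mxE => /pos_inj. Qed.

Lemma emb_surj (y : points) : exists x, emb x == y.
Proof.
have := fsvalP y; rewrite !inE => /mapP[x _ hx].
by exists x; apply/eqP/val_inj; rewrite /= hx.
Qed.

Definition dec (y : points) : I := xchoose (emb_surj y).

Lemma decK : cancel dec emb.
Proof. by move=> y; apply/eqP/(xchooseP (emb_surj y)). Qed.

Lemma embK : cancel emb dec.
Proof. by move=> x; apply: point_inj; rewrite -[LHS]/(fsval (emb (dec (emb x)))) decK. Qed.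

Lemma card_points : #|` points| = #|I|.
Proof.
rewrite cardfE; apply: bij_eq_card; exists emb; [exact: decK | exact: embK].
Qed.

Definition lab (c : {ffun I -> L}) : labeling points k := [ffun y => h (c (dec y))].

Lemma move_lab c x l : move (lab c) (emb x) (h l) = lab (upd c x l).
Proof.
apply/ffunP => y; rewrite !ffunE -(inj_eq (can_inj decK)) embK.
by case: ifP.
Qed.

Lemma sum_cluster (V : nmodType) (F : 'rV[R]_1 -> V) c l :
  \sum_(y in cluster (lab c) (h l)) F (fsval y) = \sum_(x | c x == l) F (point x).
Proof.
rewrite (reindex emb) /=; last by exists dec => y _; rewrite ?decK ?embK.
by apply: eq_bigl => x; rewrite inE ffunE embK (inj_eq (bij_inj h_bij)).
Qed.

Lemma is_clustering_lab c : (forall l, exists x, c x = l) -> is_clustering (lab c).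
Proof.
case: h_bij => h' hK h'K surj; apply/forallP => i; apply/set0Pn.
have [x hx] := surj (h' i).
by exists (emb x); rewrite inE ffunE embK hx h'K.
Qed.

Lemma card_cluster_lab c l : #|cluster (lab c) (h l)|%:R = mass (fun=> 1 : R) c l.
Proof.
rewrite -sum1_card natr_sum /mass.
exact: (sum_cluster (fun=> 1%:R)).
Qed.

Lemma Phi_lab c : Phi (lab c) = \sum_x pos x ^+ 2 - energy pos c.
Proof.
rewrite /Phi (reindex h) /=; last exact: onW_bij.
rewrite /energy.
rewrite (partition_big c predT) //= -sumrB; apply: eq_bigr => l _.
rewrite (sum_cluster (fun v => sqnorm (v - cm (cluster (lab c) (h l))))).
set n := mass (fun=> 1) c l; set s := mass pos c l.
have hcm : cm (cluster (lab c) (h l)) ord0 ord0 = s / n.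
  rewrite /cm mxE card_cluster_lab -/n mulrC; congr (_ / _).
  rewrite summxE (sum_cluster (fun v => v ord0 ord0)).
  by apply: eq_bigr => x _; rewrite mxE.
(* The final factor [1] makes the last term sum to a multiple of the cluster size [n]. *)
have eqF x : sqnorm (point x - cm (cluster (lab c) (h l))) =
    pos x ^+ 2 - 2 * (s / n) * pos x + (s / n) ^+ 2 * 1.
  by move: hcm; rewrite /sqnorm big_ord1; move: (cm _) => v hv; rewrite !mxE hv; ring.
rewrite (eq_bigr _ (fun x _ => eqF x)).
rewrite big_split sumrB -!mulr_sumr /= -/(mass pos c l) -/s.
rewrite -/(mass (fun=> 1) c l) -/n.
(* Division by [n] is genuine unless the cluster is empty, and then its sum [s] vanishes. *)
have [n0|n0] := eqVneq n 0; last by field.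
suff -> : s = 0 by rewrite n0; ring.
have N0 : cluster (lab c) (h l) = set0.
  by apply/eqP; rewrite -cards_eq0 -(pnatr_eq0 R) card_cluster_lab -/n n0.
have := sum_cluster (fun v => v ord0 ord0) c l.
rewrite N0 big_set0 => ->; apply: eq_bigr => x _.
by rewrite mxE.
Qed.

Lemma hw_step_lab c c' : gain_step pos c c' -> hw_step (lab c) (lab c').
Proof.
case/existsP => x /existsP[l /andP[/andP[nl lt] /eqP ->]].
apply/existsP; exists (emb x); apply/existsP; exists (h l).
rewrite /improving move_lab eqxx ffunE embK (inj_eq (bij_inj h_bij)) nl /=.
by rewrite !Phi_lab ltrD2l ltrN2 lt.
Qed.

Lemma ex_long_execution c s : path (gain_step pos) c s ->
  exists2 s', hw_execution (lab c) s' & (size s <= size s')%N.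
Proof.
move=> ps; have [t /andP[pt ot]] := ex_hw_execution (lab (last c s)).
exists (map lab s ++ t); last by rewrite size_cat size_map leq_addr.
rewrite /hw_execution cat_path last_cat last_map ot pt !andbT.
by apply: (homo_path (e := gain_step pos)) => // *; apply: hw_step_lab.
Qed.

End Transfer.

(** * Gadgets at geometrically growing scales *)

Section Gadgets.
Variables (R : realType) (g : nat).

Definition gpoint : finType := (unit + 'I_g * (bool * bool))%type.
Definition glabel : finType := (unit + 'I_g * bool)%type.
Implicit Types (i j : 'I_g) (ph : 'I_g -> nat) (f : gpoint -> R).

(* a = fixed i false, b = fixed i true, p = mobile i false, q = mobile i true *)
Definition fixed i (l : bool) : gpoint := inr (i, (false, l)).
Definition mobile i (s : bool) : gpoint := inr (i, (true, s)).
Definition side i (l : bool) : glabel := inr (i, l).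

Definition coord (t : bool * bool) : R :=
  match t with
  | (false, false) => - 5
  | (false, true) => 5
  | (true, false) => 3
  | (true, true) => 4
  end.

Definition gpos (x : gpoint) : R :=
  if x is inr (i, t) then 10 ^+ i * coord t else 0.

(* ph i is the number of mobile points of gadget i on the side B = true, the
   point p = mobile i false going first. *)
Definition conf ph : {ffun gpoint -> glabel} :=
  [ffun x : gpoint => match x with
    | inl u => inl u
    | inr (i, (false, l)) => side i l
    | inr (i, (true, s)) => side i (s < ph i)%N
    end].

Definition set_phase ph i n : 'I_g -> nat := fun j => if j == i then n else ph j.

Lemma eq_side i j (l l' : bool) :
  (side i l == side j l') = (i == j) && (l == l').
Proof. by rewrite (inj_eq inr_inj). Qed.

Lemma eq_mobile i j (s s' : bool) :
  (mobile i s == mobile j s') = (i == j) && (s == s').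
Proof. by rewrite (inj_eq inr_inj). Qed.

Lemma eq_fixed_mobile i j (l s : bool) : (fixed i l == mobile j s) = false.
Proof. by rewrite (inj_eq inr_inj) xpair_eqE andbF. Qed.

Lemma conf_mobile ph i (s : bool) : conf ph (mobile i s) = side i (s < ph i)%N.
Proof. by rewrite ffunE. Qed.

(** Rewrite rules that turn cluster sizes, before and after a move, into numerals, so that [lra]
    sees constant denominators. *)
Lemma small_sums : ((1 + 1 = 2 :> R)%R * (2 + 1 = 3 :> R)%R * (3 + 1 = 4 :> R)%R *
  (4 - 1 = 3 :> R)%R * (3 - 1 = 2 :> R)%R * (2 - 1 = 1 :> R)%R)%type.
Proof. by repeat split; ring. Qed.

(** The ratio of the bounds is less than the scale factor 10, which keeps points of different
    gadgets apart. *)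
Lemma coord_norm t : 3 <= `|coord t| <= 5.
Proof. by rewrite ler_norml lter_normr; case: t => -[] [] /=; lra. Qed.

Lemma gpos_neq i j t t' : (i < j)%N -> gpos (inr (i, t)) != gpos (inr (j, t')).
Proof.
move=> ltij; apply/eqP => /(congr1 Num.norm); rewrite /= !normrM !normrX !normr_nat.
have /andP[_ ut] := coord_norm t; have /andP[lt' _] := coord_norm t'.
have y0 : 0 < (10 : R) ^+ i by rewrite exprn_gt0.
have lexy : 10 * (10 : R) ^+ i <= 10 ^+ j by rewrite -exprS ler_eXn2l ?ltr1n.
move: (10 ^+ i) (10 ^+ j) y0 lexy => y z y0 lexy e.
have : y * `|coord t| <= y * 5 by rewrite ler_pM2l.
have : z * 3 <= z * `|coord t'| by rewrite ler_wpM2l //; lra.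
by rewrite e; lra.
Qed.

Lemma gpos_inj : injective gpos.
Proof.
have gpos_neq0 i t : gpos (inr (i, t)) != 0.
  have /andP[lt _] := coord_norm t.
  rewrite /= mulf_neq0 ?expf_neq0 ?pnatr_eq0 // -normr_gt0.
  exact: lt_le_trans lt.
move=> [[]|[i t]] [[]|[j t']] // e.
- by have := gpos_neq0 j t'; rewrite -e eqxx.
- by have := gpos_neq0 i t; rewrite e eqxx.
case: (ltngtP (i : nat) j) => [lt|lt|/val_inj ij].
- by have := @gpos_neq _ _ t t' lt; rewrite e eqxx.
- by have := @gpos_neq _ _ t' t lt; rewrite e eqxx.
rewrite ij in e *; congr (inr (_, _)); move: e => /= /mulfI => /(_ _) e.
have {}e : coord t = coord t' by apply: e; rewrite expf_neq0 // pnatr_eq0.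
by case: t t' e => -[] [] [[] []] //= {ij} e; exfalso; lra.
Qed.

Lemma eq_conf ph ph' : ph =1 ph' -> conf ph = conf ph'.
Proof. by move=> e; apply/ffunP => x; rewrite !ffunE; case: x => [//|[i [[] s]]]; rewrite ?e. Qed.

Lemma mass_conf f ph i (l : bool) :
  mass f (conf ph) (side i l) =
  f (fixed i l) + (if (0 < ph i)%N == l then f (mobile i false) else 0)
                + (if (1 < ph i)%N == l then f (mobile i true) else 0).
Proof.
rewrite /mass big_mkcond big_sumType /= big1 ?add0r; last by move=> u _; rewrite ffunE.
rewrite (eq_bigr (fun p : 'I_g * (bool * bool) =>
  (fun j t => if conf ph (inr (j, t)) == side i l then f (inr (j, t)) else 0) p.1 p.2)); last by case.
rewrite -(pair_bigA _ (fun j t => if conf ph (inr (j, t)) == side i l then f (inr (j, t)) else 0)).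
rewrite (bigD1 i) //= [X in _ + X]big1 ?addr0; last first.
  move=> j nji; rewrite big1 // => -[[] s] _; rewrite ffunE /side.
    by rewrite (inj_eq inr_inj) xpair_eqE (negPf nji).
  by rewrite (inj_eq inr_inj) xpair_eqE (negPf nji).
rewrite (eq_bigr (fun p : bool * bool =>
  (fun b s => if conf ph (inr (i, (b, s))) == side i l then f (inr (i, (b, s))) else 0) p.1 p.2)); last by case.
rewrite -(pair_bigA _ (fun b s => if conf ph (inr (i, (b, s))) == side i l then f (inr (i, (b, s))) else 0)).
rewrite !big_bool !ffunE /side !(inj_eq inr_inj) !xpair_eqE !eqxx /=.
by case: l; rewrite /= ?add0r ?addr0 [LHS]addrC [X in _ + X]addrC addrA.
Qed.

(** With booleans read as numbers, the next mobile point to reach B in phase [s] is the one of index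
    [s]. *)
Lemma conf_set_phase ph i (s : bool) : ph i = s ->
  upd (conf ph) (mobile i s) (side i true) = conf (set_phase ph i s.+1).
Proof.
move=> phi; apply/ffunP => x; rewrite !ffunE.
case: x => [//|[j [[] s']]]; rewrite (inj_eq inr_inj) !xpair_eqE /set_phase /=; last first.
  by rewrite andbF.
by case: eqP => [->|//] /=; case: eqP => [->|]; rewrite ?ltnSn // phi; case: s s' {phi} => -[].
Qed.

Definition reach (n : nat) (c c' : {ffun gpoint -> glabel}) :=
  exists s, [/\ path (gain_step gpos) c s, last c s = c' & (n <= size s)%N].

Lemma reach_trans m n c1 c2 c3 :
  reach m c1 c2 -> reach n c2 c3 -> reach (m + n) c1 c3.
Proof.
move=> [s [ps <- ms]] [t [pt <- nt]]; exists (s ++ t).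
by rewrite cat_path ps pt last_cat size_cat leq_add.
Qed.

Lemma reach_leq m n c c' : (m <= n)%N -> reach n c c' -> reach m c c'.
Proof. by move=> mn [s [ps ls ns]]; exists s; split=> //; apply: leq_trans ns. Qed.

Lemma reach_step c c' : gain_step gpos c c' -> reach 1 c c'.
Proof. by move=> st; exists [:: c']; rewrite /= st. Qed.

Lemma direct_step ph i (s : bool) : ph i = s ->
  gain_step gpos (conf ph) (conf (set_phase ph i s.+1)).
Proof.
move=> phi; rewrite -conf_set_phase //.
apply: gain_step_upd; rewrite conf_mobile phi ltnn; first by rewrite eq_side andbF.
rewrite !mass_conf phi /=.
(* Both sides are numerical multiples of the squared scale, so positivity of that square leaves a
   linear problem. *)
have y2 : 0 < ((10 : R) ^+ i) ^+ 2 by rewrite !exprn_gt0.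
move: (10 ^+ i) y2 => y y2.
by case: s {phi}; rewrite /= !(addr0, add0r, subr0, small_sums); lra.
Qed.

(* The route of a mobile point of gadget i through gadget j = i - 1, which is
   thereby reset from phase 2 to phase 0. *)
Lemma detour ph i j (s : bool) :
  i = j.+1 :> nat -> ph i = s -> ph j = 2 ->
  reach 4 (conf ph) (conf (set_phase (set_phase ph i s.+1) j 0)).
Proof.
move=> ij phi phj.
have nij : (i == j) = false by rewrite -val_eqE /= ij gtn_eqF.
have nji : (j == i) = false by rewrite eq_sym.
(* The visitor enters cluster B of gadget [j], the points p and q of gadget [j] flee in turn to its
   cluster A, and the visitor goes on to its own B. *)
pose c1 := upd (conf ph) (mobile i s) (side j true).
pose c2 := upd c1 (mobile j false) (side j false).
pose c3 := upd c2 (mobile j true) (side j false).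
pose c4 := upd c3 (mobile i s) (side i true).
have labE := (updE, conf_mobile, eq_side, eq_mobile, eqxx, nij, nji, phi, phj, ltnn).
have y2 : 0 < ((10 : R) ^+ j) ^+ 2 by rewrite !exprn_gt0.
have massE := (mass_upd, mass_conf).
(* In units of [10 ^+ j] the visitor sits at 30 or 40. *)
have ei : (10 : R) ^+ i = 10 * 10 ^+ j by rewrite ij exprS.
have st1 : gain_step gpos (conf ph) c1.
  apply: gain_step_upd; first by rewrite !labE.
  rewrite !labE !massE !labE /= ei.
  move: (10 ^+ j) y2 => y y2.
  by case: (s); rewrite /= !(addr0, add0r, subr0, small_sums); lra.
have st2 : gain_step gpos c1 c2.
  apply: gain_step_upd; first by rewrite !labE.
  rewrite !labE !massE !labE /= ei.
  move: (10 ^+ j) y2 => y y2.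
  by case: (s); rewrite /= !(addr0, add0r, subr0, small_sums); lra.
have st3 : gain_step gpos c2 c3.
  apply: gain_step_upd; first by rewrite !labE.
  rewrite !labE !massE !labE /= ei.
  move: (10 ^+ j) y2 => y y2.
  by case: (s); rewrite /= !(addr0, add0r, subr0, small_sums); lra.
have st4 : gain_step gpos c3 c4.
  apply: gain_step_upd; first by rewrite !labE.
  rewrite !labE !massE !labE /= ei.
  move: (10 ^+ j) y2 => y y2.
  by case: (s); rewrite /= !(addr0, add0r, subr0, small_sums); lra.
have -> : conf (set_phase (set_phase ph i s.+1) j 0) = c4.
  apply/ffunP => -[u|[k [[] t]]].
  - by rewrite !updE !ffunE.
  - rewrite -/(mobile k t) !updE !eq_mobile !conf_mobile /set_phase.
    have [->|nkj] := eqVneq k j; first by rewrite nji phj; case: t.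
    have [->|//] := eqVneq k i.
    by rewrite phi; case: s t {c1 c2 c3 c4 st1 st2 st3 st4 phi labE} => -[].
  - by rewrite -/(fixed k t) !updE !eq_fixed_mobile !ffunE.
by exists [:: c1; c2; c3; c4]; rewrite /= st1 st2 st3 st4.
Qed.

(** Induction on [i]: gadget 0 makes two direct moves, while a larger gadget makes two detours, each
    waking its predecessor, which by induction falls asleep again. Hence the bound doubles. *)
Lemma wake i ph : ph i = 0 -> (forall j : 'I_g, (j < i)%N -> ph j = 2) ->
  reach (2 ^ i.+1) (conf ph) (conf (set_phase ph i 2)).
Proof.
case: i ph => i; elim: i => [|i IH] ltig ph ph0 sleep; set I := Ordinal _.
  apply: (@reach_leq _ (1 + 1)) => //.
  apply: reach_trans (reach_step (direct_step (i := I) (s := false) ph0)) _.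
  have -> : conf (set_phase ph I 2) = conf (set_phase (set_phase ph I 1) I 2).
    by apply: eq_conf => j; rewrite /set_phase; case: eqP.
  by apply/reach_step/(direct_step (s := true)); rewrite /set_phase eqxx.
have advance (s : bool) ph' : ph' I = s -> (forall j : 'I_g, (j < I)%N -> ph' j = 2) ->
    reach (2 ^ i.+1) (conf ph') (conf (set_phase ph' I s.+1)).
  move=> phI sleep'; pose J := Ordinal (ltnW ltig).
  have nJI : (J == I) = false by rewrite -val_eqE /= ltn_eqF.
  have phJ : ph' J = 2 by apply: sleep'.
  (* The four moves of the detour itself are dropped from the count. *)
  apply: (@reach_leq _ (4 + 2 ^ i.+1)); first exact: leq_addl.
  have d := detour (erefl : I = J.+1 :> nat) phI phJ; apply: (reach_trans d) _.
  have := IH (ltnW ltig) (set_phase (set_phase ph' I s.+1) J 0).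
  rewrite -/J {1}/set_phase eqxx => /(_ erefl) r.
  (* Once [J] sleeps again, the only net change is the advance of [I]. *)
  have -> : conf (set_phase ph' I s.+1) =
      conf (set_phase (set_phase (set_phase ph' I s.+1) J 0) J 2).
    apply: eq_conf => k; rewrite /set_phase.
    by have [->|//] := eqVneq k J; rewrite nJI phJ.
  apply: r => k ltk; rewrite /set_phase.
  rewrite -!val_eqE /= (ltn_eqF ltk) ltn_eqF ?sleep' //=; exact: ltn_trans ltk _.
have -> : conf (set_phase ph I 2) = conf (set_phase (set_phase ph I 1) I 2).
  by apply: eq_conf => j; rewrite /set_phase; case: eqP.
rewrite expnS mul2n -addnn.
apply: reach_trans (advance false _ ph0 sleep) _.
apply: (advance true); first by rewrite /set_phase eqxx.
by move=> j ltj; rewrite /set_phase -val_eqE ltn_eqF ?sleep.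
Qed.

End Gadgets.

(** * The exponential lower bound *)

Lemma powR_pow2 (R : realType) (a : R) n : a <= n%:R -> 2 `^ a <= 2 ^+ n :> R.
Proof.
by move=> an; rewrite -powR_mulrn ?ler0n //; apply: ler_powR => //; rewrite ler1n.
Qed.

Theorem theorem1 (R : realType) :
  exists c : R, 0 < c /\
    forall m : nat, (2 <= m)%N ->
      exists (X : {fset 'rV[R]_1}) (C0 : labeling X (2 * m - 1)%N)
             (s : seq (labeling X (2 * m - 1)%N)),
        [/\ #|` X| = (4 * m - 3)%N,
            is_clustering C0,
            hw_execution C0 s
          & powR 2 (c * (4 * m - 3)%N%:R) <= (size s)%:R].
Proof.
(* With [m = g + 2] there are [g + 1] gadgets and [4 * g + 5] points, at most [5 * (g + 1)], against
   [2 ^ (g + 1)] iterations. *)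
exists 5^-1; split=> [|m]; first by rewrite invr_gt0.
case: m => [//|[//|g]] _.
have cardL : #|glabel g.+1| = (2 * g.+2 - 1)%N.
  by rewrite card_sum card_prod card_unit card_ord card_bool; lia.
pose h l := cast_ord cardL (enum_rank l).
have h_bij : bijective h.
  exists (fun k => enum_val (cast_ord (esym cardL) k)) => [l|k].
    by rewrite /h cast_ordK enum_rankK.
  by rewrite /h enum_valK cast_ordKV.
(* Only the largest gadget starts awake. *)
pose ph0 (i : 'I_g.+1) := if i == ord_max then 0%N else 2%N.
have [|j ltj|s [ps _ les]] := @wake R g.+1 ord_max ph0.
- by rewrite /ph0 eqxx.
- by rewrite /ph0 -val_eqE ltn_eqF.
have [t ht lest] := ex_long_execution (@gpos_inj R g.+1) h_bij ps.
exists (points (@gpos R g.+1)), (lab (@gpos R g.+1) h (conf ph0)), t; split=> //.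
- rewrite (card_points (@gpos_inj R g.+1)).
  by rewrite card_sum !card_prod card_unit card_ord !card_bool; lia.
(* The point 0 and the fixed points a and b keep every cluster nonempty. *)
- apply: (is_clustering_lab (@gpos_inj R g.+1) h_bij) => -[u|[i l]]; first by exists (inl u); rewrite ffunE.
  by exists (fixed i l); rewrite ffunE.
apply: (@le_trans _ _ (2 ^+ g.+1)); last first.
  rewrite -natrX ler_nat; apply: leq_trans lest; apply: leq_trans les.
  by rewrite leq_exp2l.
apply: powR_pow2.
have : (4 * g.+2 - 3 <= 5 * g.+1)%N by lia.
by rewrite -(ler_nat R) natrM; lra.
Qed.
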